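(* Let $G$ be a finite soluble group. Then $G$ is a $PT$-group if and only if ${\cal L}_{\mathfrak{N}}(G)={\cal L}_{\Delta}(G)$, where $\mathfrak{N}$ is the class of all nilpotent groups and $\Delta$ is the set of all central chief factors $H/K$ of $G$, and every two subgroups $A$ and $B$ of any Sylow subgroup of $G$ are permutable, that is, $AB=BA$.
   Context: For $A\le G$: $A^{G}$ is the normal closure of $A$ in $G$ and $A_{G}=\bigcap_{x\in G}A^{x}$ is the core of $A$ in $G$. A subgroup $A$ of $G$ is permutable (equivalently, quasinormal) in $G$ if $AH=HA$ for all subgroups $H$ of $G$. $G$ is a $PT$-group if every subnormal subgroup of $G$ is permutable in $G$. A chief factor of $G$ is a section $H/K$ with $K<H$ normal in $G$ and $H/K$ a minimal normal subgroup of $G/K$; it is central if $H/K\le Z(G/K)$. For a set $\Delta$ of chief factors of $G$ and normal subgroups $L\le T$ of $G$, write $T/L\le Z_{\Delta}(G)$ if either $L=T$, or $L<T$ and $H/K\in\Delta$ for every chief factor $H/K$ of $G$ with $L\le K<H\le T$. ${\cal L}_{\Delta}(G)$ is the set of all subgroups $A$ of $G$ such that $A^{G}/A_{G}\le Z_{\Delta}(G)$. ${\cal L}_{\mathfrak{N}}(G)$ is the set of all subgroups $A$ of $G$ such that $A^{G}/A_{G}$ is nilpotent. *)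

(* Defs.v *)
From mathcomp Require Import all_boot all_fingroup all_solvable.

Set Implicit Arguments.
Unset Strict Implicit.
Unset Printing Implicit Defensive.

Local Open Scope group_scope.

Section Definitions.

Variable gT : finGroupType.
Implicit Types (A G H K L T : {group gT}).

Definition normal_closure A G : {group gT} := <<class_support A G>>%G.

Definition core A G : {group gT} := [group of gcore A G].

(* The product A * H is the set of products; A need not normalise H. *)
Definition permutable A G : Prop :=
  A \subset G /\ forall H, H \subset G -> A * H = H * A.

Definition PT_group G : Prop :=
  forall A, A <|<| G -> permutable A G.

(* A factor H / K is encoded as the pair (H, K) with the larger group first,
   whereas the arguments of chief_factor G K H come in the other order. *)
Definition central_chief_factors G : {set {group gT} * {group gT}} :=
  [set HK : {group gT} * {group gT} |
     chief_factor G HK.2 HK.1 & HK.1 / HK.2 \subset 'Z(G / HK.2)].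

(* T / L <= Z_Delta(G) *)
Definition sub_ZDelta (Delta : {set {group gT} * {group gT}}) G T L : bool :=
  (L == T) ||
  (L \proper T) &&
    [forall H : {group gT}, forall K : {group gT},
       [&& chief_factor G K H, L \subset K, K \proper H & H \subset T]
         ==> ((H, K) \in Delta)].

Definition L_Delta (Delta : {set {group gT} * {group gT}}) G :
    {set {group gT}} :=
  [set A : {group gT} | A \subset G &
     sub_ZDelta Delta G (normal_closure A G) (core A G)].

Definition L_nilpotent G : {set {group gT}} :=
  [set A : {group gT} | A \subset G &
     nilpotent (normal_closure A G / core A G)].

End Definitions.

(* Main.v *)
Require Import Defs.
From mathcomp Require Import all_boot all_fingroup all_solvable.

(** Write C for the core of A in G. The condition defining [L_nilpotent] says
    that A / C lies in the Fitting subgroup of G / C ([L_nilpotentP]); the one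
    defining [L_Delta], for the central chief factors, says that A / C lies in
    the hypercentre of G / C, that is, in some term of its upper central series
    ([L_DeltaP]). Hence [L_Delta] is always contained in [L_nilpotent].

    Suppose that G is a soluble PT-group. Every subgroup of the Fitting
    subgroup is subnormal, hence permutable. For a prime p put P = 'O_p(G). If
    some p'-subgroup does not centralise P, then every subgroup of P is normal
    in G ([permutable_pcore_dichotomy]). Indeed a subgroup of G that meets P
    trivially normalises every subgroup of P, because A * H = H * A and the
    Dedekind law give A = A * H :&: P. A noncentral Sylow q-subgroup Q, q <> p,
    therefore acts on P by power automorphisms, and such a coprime nontrivial
    action has no fixed point; so the normaliser of Q meets P trivially, and
    the Frattini argument extends the normalising from p'-subgroups to G.
    If on the contrary all p'-subgroups centralise P, then P is hypercentral.
    So a core-free subgroup of the Fitting subgroup is hypercentral, and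
    [L_nilpotent] = [L_Delta] follows by passing to G / C. For the Sylow
    p-subgroups one factors out 'O_p^'(G); then 'F(G) = 'O_p(G) contains its
    centraliser, and the same dichotomy shows either that G is a p-group or
    that the derived subgroup centralises 'O_p(G), in which case the Sylow
    p-subgroup is 'O_p(G) and all its subgroups are normal in G.

    Conversely, let A be subnormal and let B / C be the Fitting subgroup of
    A / C. Then B belongs to [L_nilpotent] and has core C, so 'F(A / C) is
    hypercentral in G / C, which forces the soluble group A / C to be nilpotent
    ([nilpotent_Fitting_hypercentral]). Thus A itself belongs to [L_nilpotent]
    and A / C is hypercentral. The q-part of a normal hypercentral subgroup is
    centralised by every q'-subgroup and, with the hypothesis on the Sylow
    subgroups, permutes with every q-subgroup; so A / C permutes with all
    subgroups of G / C ([hypercentral_permute]). *)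

Set Implicit Arguments.
Unset Strict Implicit.
Unset Printing Implicit Defensive.

Local Open Scope group_scope.

(** * Hypercentral sections *)

(** Membership of subgroups in the upper central series is tested by
    commutation with the whole group, one step at a time. *)
Lemma sub_ucnS (gT : finGroupType) n (G X : {group gT}) :
  X \subset G -> (X \subset 'Z_n.+1(G)) = ([~: X, G] \subset 'Z_n(G)).
Proof.
move=> sXG; apply/idP/idP=> [XZ | RZ].
  exact: subset_trans (commSg _ XZ) (ucn_comm n G).
have nZG := ucn_norm n G; have nZX := subset_trans sXG nZG.
rewrite ucnSn -sub_quotient_pre // subsetI quotientS //=.
by rewrite quotient_cents2.
Qed.

Section Hypercentral.

Variable gT : finGroupType.
Implicit Types (A B G H K L P Q T X Z : {group gT}) (p n : nat).

(** Hypercentrality can be checked on the Sylow subgroups, since the upper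
    central series is increasing. *)
Lemma sub_ucn_Sylow A G :
    (forall Q, Sylow A Q -> exists n, Q \subset 'Z_n(G)) ->
  exists n, A \subset 'Z_n(G).
Proof.
move=> sylZ.
have /fin_all_exists[f fP] Q : exists n, Sylow A Q -> Q \subset 'Z_n(G).
  by case: (boolP (Sylow A Q)) => [/sylZ[n] | _]; [exists n | exists 0].
exists (\max_Q f Q); rewrite -(Sylow_gen A) gen_subG; apply/bigcupsP=> Q sylQ.
exact: subset_trans (fP Q sylQ) (ucn_sub_geq _ (leq_bigmax Q)).
Qed.

(** The lower central series of B reaches Z and then descends through the
    upper central series of G. *)
Lemma nilpotent_hypercentral_ext n G B Z :
    B \subset G -> Z <| B -> Z \subset 'Z_n(G) -> nilpotent (B / Z) ->
  nilpotent B.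
Proof.
move=> sBG /andP[_ nZB] ZZ /lcnP[k LkZ].
have sLkZ : 'L_k.+1(B) \subset 'Z_n(G).
  apply: subset_trans ZZ; rewrite -quotient_sub1 ?(subset_trans (lcn_sub _ _)) //.
  by rewrite /quotient morphim_lcn // -/(quotient _ _) LkZ.
suff L1 m i : 'L_i.+1(B) \subset 'Z_m(G) -> exists j, 'L_j.+1(B) = 1.
  exact/lcnP/(L1 n k sLkZ).
elim: m i => [|m IHm] i; first by rewrite ucn0 => /trivgP; exists i.
move=> LiZ; apply: (IHm i.+1); rewrite lcnSn.
exact: subset_trans (commgSS LiZ sBG) (ucn_comm m G).
Qed.

(** P <*> X is nilpotent, being an extension of a hypercentral subgroup by a
    nilpotent group, and coprime subgroups of a nilpotent group commute. *)
Lemma coprime_cent_hypercentral n G P X :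
    P <| G -> P \subset 'Z_n(G) -> X \subset G -> nilpotent X ->
  coprime #|P| #|X| -> X \subset 'C(P).
Proof.
move=> nsPG PZ sXG nilX coPX; have [sPG nPG] := andP nsPG.
have nPX := subset_trans sXG nPG.
have sPXG : P <*> X \subset G by rewrite join_subG sPG.
have nilPX : nilpotent (P <*> X).
  apply: (nilpotent_hypercentral_ext (n := n) (G := G) (Z := P)) => //.
    by rewrite /normal joing_subl join_subG normG.
  by rewrite quotientYidl // quotient_nil.
exact: sub_nilpotent_cent2 nilPX (joing_subl _ _) (joing_subr _ _) coPX.
Qed.

Lemma quotient_sub_ucnS n G X L :
    X \subset G -> L <| G ->
  (X / L \subset 'Z_n.+1(G / L)) = ([~: X, G] / L \subset 'Z_n(G / L)).
Proof.
move=> sXG /andP[_ nLG].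
by rewrite sub_ucnS ?quotientS // quotientR // (subset_trans sXG).
Qed.

Lemma sub_quotient_ucn n G X L K :
    X \subset G -> L <| G -> K <| G -> L \subset K ->
  X / L \subset 'Z_n(G / L) -> X / K \subset 'Z_n(G / K).
Proof.
move=> sXG nsLG nsKG sLK; have [[_ nLG] [_ nKG]] := (andP nsLG, andP nsKG).
elim: n X sXG => [|n IHn] X sXG.
  rewrite !ucn0 !quotient_sub1 ?(subset_trans sXG nLG) ?(subset_trans sXG nKG) //.
  by move=> sXL; apply: subset_trans sXL sLK.
rewrite !quotient_sub_ucnS //; apply: IHn.
by rewrite (subset_trans (commSg G sXG)) // commg_subl normG.
Qed.

(** The preimage of the Fitting subgroup of A / Z, for Z the hypercentral part
    of A, is nilpotent, hence contained in 'F(A) and so in Z; as A / Z is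
    soluble, it must be trivial. *)
Lemma nilpotent_Fitting_hypercentral n G A :
  A \subset G -> solvable A -> 'F(A) \subset 'Z_n(G) -> nilpotent A.
Proof.
move=> sAG solA FZ.
pose Z := ('Z_n(G) :&: A)%G; have ZZ : Z \subset 'Z_n(G) := subsetIl _ _.
have nsZA : Z <| A.
  by rewrite /normal subsetIr normsI ?normG // (subset_trans sAG) // ucn_norm.
have [sZA nZA] := andP nsZA.
apply: (nilpotent_hypercentral_ext sAG nsZA ZZ).
suff -> : A / Z = 1 by exact: nilpotent1.
apply/eqP; rewrite -trivg_Fitting ?quotient_sol // -subG1.
pose B := (coset Z @*^-1 'F(A / Z))%G.
have nsBA : B <| A by rewrite -[gval A](quotientGK nsZA) cosetpre_normal Fitting_normal.
have nilB : nilpotent B.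
  apply: (nilpotent_hypercentral_ext (n := n) (G := G) (Z := Z)) => //.
  - exact: subset_trans (normal_sub nsBA) sAG.
  - by rewrite /normal sub_cosetpre (subset_trans (normal_sub nsBA)).
  by rewrite cosetpreK Fitting_nil.
have sBZ : B \subset Z.
  by rewrite subsetI (normal_sub nsBA) (subset_trans (Fitting_max nsBA nilB)).
suff: B / Z \subset [1] by rewrite cosetpreK.
by rewrite quotient_sub1 // (subset_trans sBZ) ?normG.
Qed.

(** A chief factor H / K in a hypercentral section is central: otherwise
    H = K [H, G], and H / K would descend to the bottom of the upper central
    series of G / K. *)
Lemma ucn_chief_central n G L T H K :
    L <| G -> T / L \subset 'Z_n(G / L) ->
    chief_factor G K H -> L \subset K -> H \subset T ->
  H / K \subset 'Z(G / K).
Proof.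
move=> nsLG TZ /andP[/maxgroupP[/andP[prKH nKG] maxK] /andP[sHG nHG]] sLK sHT.
have [sKH not_sHK] := andP prKH; have [sLG nLG] := andP nsLG.
have nKH := subset_trans sHG nKG.
have nsKG : K <| G by rewrite /normal nKG (subset_trans sKH).
suff sRK : [~: H, G] \subset K.
  by rewrite subsetI quotientS //= quotient_cents2.
have sRH : [~: H, G] \subset H by rewrite commg_subl.
case: (eqVneq (K <*> [~: H, G])%G H) => [defH | neqH].
  case/negP: not_sHK; rewrite -quotient_sub1 //.
  have: H / K \subset 'Z_n(G / K).
    apply: (sub_quotient_ucn (L := L)) => //.
    exact: subset_trans (quotientS L sHT) TZ.
  elim: n {TZ} => [|n IHn] HZ; first by rewrite ucn0 in HZ.
  apply: IHn; rewrite -defH /= quotientYidl ?(subset_trans sRH) //.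
  by rewrite -quotient_sub_ucnS.
(* Maximality of K below H leaves no other choice for K [H, G]. *)
have <- : (K <*> [~: H, G])%G = K; last exact: joing_subr.
apply/val_inj; apply: maxK; last exact: joing_subl.
rewrite normsY ?normsR ?normG // andbT properEneq join_subG sKH sRH andbT.
by rewrite neqH.
Qed.

Lemma chief_central_ucn G L T :
    L <| G -> T <| G -> L \subset T ->
    (forall H K, chief_factor G K H -> L \subset K -> H \subset T ->
       H / K \subset 'Z(G / K)) ->
  exists n, T / L \subset 'Z_n(G / L).
Proof.
move=> nsLG; have [m] := ubnP #|T|; elim: m T => // m IHm T leTm nsTG sLT centT.
have [sTG nTG] := andP nsTG; have [_ nLG] := andP nsLG.
case: (eqVneq L T) => [<- | neqLT]; first by exists 0; rewrite ucn0 trivg_quotient.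
have [|K maxK sLK] := @maxgroup_exists _
    (fun K : {group gT} => (K \proper T) && (G \subset 'N(K))) L.
  by rewrite nLG andbT properEneq sLT andbT.
have /maxgroupp/andP[prKT nKG] := maxK; have sKT := proper_sub prKT.
have nsKG : K <| G by rewrite /normal nKG (subset_trans sKT).
have [||n KZ] := IHm K _ nsKG sLK.
- exact: leq_trans (proper_card prKT) _.
- by move=> H K1 chH sLK1 sHK; apply: centT chH sLK1 (subset_trans sHK sKT).
exists n.+1; rewrite quotient_sub_ucnS //; apply: subset_trans KZ; apply: quotientS.
have chTK : chief_factor G K T by rewrite /chief_factor /maxnormal maxK.
have := centT T K chTK sLK (subxx _); rewrite subsetI => /andP[_].
by rewrite quotient_cents2 // (subset_trans sTG).
Qed.

(** For the set of central chief factors, T / L <= Z_Delta(G) means that T / L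
    is hypercentral in G / L. *)
Lemma sub_ZDelta_centralP G L T :
    L <| G -> T <| G -> L \subset T ->
  reflect (exists n, T / L \subset 'Z_n(G / L))
          (sub_ZDelta (central_chief_factors G) G T L).
Proof.
move=> nsLG nsTG sLT; apply: (iffP idP) => [DT | [n TZ]].
  apply: chief_central_ucn => // H K chH sLK sHT.
  have /maxgroupp/andP[prKH _] : maxnormal K H G by case/andP: chH.
  have sKH := proper_sub prKH.
  case/orP: DT => [/eqP eqLT | /andP[_ /forallP/(_ H)/forallP/(_ K)]].
    by case/andP: prKH => _ /negP[]; rewrite (subset_trans sHT) // -eqLT.
  by rewrite chH sLK prKH sHT inE /= => /andP[].
rewrite /sub_ZDelta; case: (eqVneq L T) => //= neqLT.
rewrite properEneq neqLT sLT /=.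
apply/forallP=> H; apply/forallP=> K; apply/implyP=> /and4P[chH sLK _ sHT].
by rewrite inE chH (ucn_chief_central nsLG TZ).
Qed.

End Hypercentral.

(** * Permutable subgroups *)

Section Permutable.

Variable gT : finGroupType.
Implicit Types (A B C G H K P Q S U X : {group gT}) (p q : nat).

(** A subgroup permuting with each member of a family permutes with the
    subgroup that the family generates. *)
Lemma permute_gen A (T : {set {group gT}}) :
    (forall P, P \in T -> A * P = P * A) ->
  A * <<\bigcup_(P in T) P>> = <<\bigcup_(P in T) P>> * A.
Proof.
move=> AT; set H := <<_>>.
(* The reverse inclusion is the image of this one under inversion. *)
suff sAH : A * H \subset H * A.
  apply/eqP; rewrite eqEsubset sAH /= -invSg !invMg !invGid.
  exact: sAH.
pose S := [set x in H | A :* x \subset H * A].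
have gS : group_set S.
  apply/group_setP; split=> [|x y].
    by rewrite inE group1 mulg1 mulG_subr.
  rewrite !inE => /andP[Hx Ax] /andP[Hy Ay]; rewrite groupM //=.
  rewrite rcosetM (subset_trans (mulSg _ Ax)) // -mulgA.
  by rewrite (subset_trans (mulgS _ Ay)) // mulgA mulGid.
have sHS : H \subset S.
  rewrite -[S]/(gval (Group gS)) gen_subG; apply/bigcupsP=> P TP /=.
  have sPH : P \subset H by rewrite sub_gen // (bigcup_max P).
  apply/subsetP=> x Px; rewrite inE (subsetP sPH) //=.
  have sxP : [set x] \subset P by rewrite sub1set.
  by rewrite (subset_trans (mulgS A sxP)) // AT // mulSg.
apply/subsetP=> _ /mulsgP[a x Aa Hx ->].
have := subsetP sHS x Hx; rewrite inE => /andP[_ /subsetP]; apply.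
by rewrite mem_rcoset mulgK.
Qed.

Lemma permute_Sylow A H :
  (forall P, Sylow H P -> A * P = P * A) -> A * H = H * A.
Proof.
move=> sylA; have := permute_gen (A := A) (T := [set P : {group gT} | Sylow H P]).
have -> : \bigcup_(P in [set P : {group gT} | Sylow H P]) P =
          \bigcup_(P : {group gT} | Sylow H P) P.
  by apply: eq_bigl => P; rewrite inE.
by rewrite Sylow_gen; apply=> P; rewrite inE => /sylA.
Qed.

(** By the Dedekind law A is the intersection of the group A * H with P. *)
Lemma permutable_norm_TI G P A H :
    P <| G -> A \subset P -> permutable A G -> H \subset G -> H :&: P = 1 ->
  H \subset 'N(A).
Proof.
move=> /andP[_ nPG] sAP [_ permA] sHG tiHP; have cAH := permA H sHG.
have defA : gval A = (A <*> H) :&: P.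
  by rewrite comm_joingE // -group_modl // tiHP mulg1.
rewrite defA normsI ?(subset_trans sHG nPG) //.
exact: subset_trans (joing_subr A H) (normG _).
Qed.

(** The subgroups of a cyclic p-group form a chain, so of the two subgroups
    'C_U(X) and [~: U, X], which meet trivially, one is trivial. *)
Lemma coprime_cyclic_cent_TI p U X :
    p.-group U -> p^'.-group X -> cyclic U -> X \subset 'N(U) ->
  ~~ (X \subset 'C(U)) -> 'C_U(X) = 1.
Proof.
move=> pU p'X cycU nUX not_cUX.
have tiCR := coprime_abel_cent_TI nUX (pnat_coprime pU p'X) (cyclic_abelian cycU).
have sRU : [~: U, X] \subset U by rewrite commg_subl.
have sCU : 'C_U(X) \subset U := subsetIl _ _.
have [n oR] := p_natP (pgroupS sRU pU); have [m oC] := p_natP (pgroupS sCU pU).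
have [le_nm | /ltnW le_mn] := leqP n m.
  case/negP: not_cUX; rewrite centsC; apply/commG1P.
  have sRC : [~: U, X] \subset 'C_U(X).
    by rewrite -(cardSg_cyclic cycU) // oR oC dvdn_exp2l.
  apply/trivgP; rewrite -tiCR subsetI subxx.
  exact: subset_trans sRC (subsetIr _ _).
have sCR : 'C_U(X) \subset [~: U, X].
  by rewrite -(cardSg_cyclic cycU) // oR oC dvdn_exp2l.
by apply/trivgP; rewrite -tiCR subsetI sCR subsetIr.
Qed.

(** A nontrivial coprime action normalising every subgroup of a p-group has no
    nontrivial fixed point. *)
Lemma power_aut_cent_TI p P X :
    p.-group P -> p^'.-group X ->
    (forall U : {group gT}, U \subset P -> X \subset 'N(U)) ->
  ~~ (X \subset 'C(P)) -> 'C_P(X) = 1.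
Proof.
move=> pP p'X nX not_cPX.
have cycTI u : u \in P -> ~~ (X \subset 'C[u]) -> 'C_<[u]>(X) = 1.
  move=> Pu not_cuX; have sUP : <[u]> \subset P by rewrite cycle_subG.
  apply: coprime_cyclic_cent_TI (pgroupS sUP pP) p'X (cycle_cyclic u) _ _.
    exact: nX.
  by rewrite cent_cycle.
have order_p u : u \in P -> ~~ (X \subset 'C[u]) ->
    exists2 v, v \in <[u]> & prime #[v] /\ ~~ (X \subset 'C[v]).
  move=> Pu not_cuX; have sUP : <[u]> \subset P by rewrite cycle_subG.
  have ntU : <[u]> != 1.
    by apply: contraNneq not_cuX => /eqP; rewrite cycle_eq1 => /eqP->; rewrite cent11T subsetT.
  have [p_pr p_dv _] := pgroup_pdiv (pgroupS sUP pP) ntU.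
  have [v Uv ov] := Cauchy p_pr p_dv; exists v => //; split; first by rewrite ov.
  apply/negP=> cvX; have: v \in 'C_<[u]>(X) by rewrite inE Uv -sub_cent1.
  by rewrite cycTI // => /set1P v1; rewrite v1 order1 in ov; rewrite -ov in p_pr.
(* If c is fixed, u of prime order is moved, and c commutes with u, then
   [u, x] = [u * c, x] is a nontrivial element of both <[u]> and <[u * c]>, so
   <[u * c]> contains u and hence c, although it has no nontrivial fixed
   point. *)
have indep u c : u \in P -> prime #[u] -> ~~ (X \subset 'C[u]) ->
    c \in 'C_P(X) -> commute u c -> c = 1.
  move=> Pu u_pr not_cuX /setIP[Pc cXc] cuc.
  have [x Xx not_cux] : exists2 x, x \in X & x \notin 'C[u] by apply/subsetPn.
  have fixE w : (x \in 'C[w]) = (w ^ x == w).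
    by rewrite -cent1C (sameP cent1P commgP) (sameP conjg_fixP eqP).
  have cxc : c ^ x = c by apply/conjg_fixP/commgP/(centP cXc).
  have nUx w : w \in P -> w ^ x \in <[w]>.
    move=> Pw; rewrite memJ_norm ?cycle_id //.
    by rewrite (subsetP (nX <[w]>%G _)) ?cycle_subG.
  have not_cvX : ~~ (X \subset 'C[u * c]).
    apply/subsetPn; exists x => //; apply: contra not_cux.
    by rewrite !fixE conjMg cxc => /eqP/mulIg->.
  have Pv : u * c \in P by rewrite groupM.
  have Uux : u^-1 * u ^ x \in <[u]> by rewrite groupM ?groupV ?cycle_id ?nUx.
  have Vux : u^-1 * u ^ x \in <[u * c]>.
    have -> : u^-1 * u ^ x = (u * c)^-1 * (u * c) ^ x.
      have cyc : u ^ x * c = c * u ^ x by rewrite -[in LHS]cxc -conjMg cuc conjMg cxc.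
      by rewrite conjMg cxc cyc cuc invMg -mulgA mulKg.
    by rewrite groupM ?groupV ?cycle_id ?nUx.
  have sUV : <[u]> \subset <[u * c]>.
    apply: contraR not_cux => not_sUV.
    have tiUV := prime_TIg u_pr not_sUV.
    have: u^-1 * u ^ x \in <[u]> :&: <[u * c]> by rewrite inE Uux.
    rewrite tiUV => /set1P/eqP; by rewrite -eq_mulVg1 fixE eq_sym.
  have Vc : c \in <[u * c]>.
    by rewrite -(groupMl _ (subsetP sUV u (cycle_id u))) cycle_id.
  by apply/set1P; rewrite -[[set 1]](cycTI _ Pv not_cvX) inE Vc.
have sub_cent1 A : ~~ (X \subset 'C(A)) -> exists2 u, u \in A & ~~ (X \subset 'C[u]).
  rewrite centsC => /subsetPn[u Au not_cu]; exists u => //.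
  by rewrite sub_cent1.
apply/trivgP/subsetP=> c Cc; apply/set1P.
(* A commuting pair exists: if 'Z(P) is fixed, pair one of its elements with
   any moved element; otherwise pair a moved element of 'Z(P) with c. *)
have [cZX | not_cZX] := boolP (X \subset 'C('Z(P))).
  have ntZ : 'Z(P) != 1.
    rewrite (center_nil_eq1 (pgroup_nil pP)).
    by apply: contra not_cPX => /eqP->; rewrite cents1.
  have [z Zz ntz] := trivgPn _ ntZ.
  have [u Pu not_cuX] := sub_cent1 P not_cPX.
  have [v Uv [v_pr not_cvX]] := order_p u Pu not_cuX.
  have Pv : v \in P by rewrite (subsetP _ v Uv) // cycle_subG.
  case/eqP: ntz; apply: (indep v) => //.
    by rewrite inE (subsetP (center_sub P)) // (subsetP _ z Zz) // centsC.
  by apply/commute_sym/(centP (subsetP (subsetIr _ _) z Zz)).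
have [u Zu not_cuX] := sub_cent1 'Z(P)%G not_cZX.
have Pu := subsetP (center_sub P) u Zu.
have [v Uv [v_pr not_cvX]] := order_p u Pu not_cuX.
have Zv : v \in 'Z(P) by rewrite (subsetP _ v Uv) // cycle_subG.
apply: (indep v) => //; first exact: subsetP (center_sub P) v Zv.
by case/setIP: Zv => _ /centP; apply; case/setIP: Cc.
Qed.

Lemma sub_Sylow_mul_cent p G P S :
    P <| G -> p.-Sylow(G) S ->
    (forall Q, Sylow G Q -> p^'.-group Q -> Q \subset 'C(P)) ->
  G \subset S * 'C_G(P).
Proof.
move=> nsPG sylS cP; have [sSG pS _] := and3P sylS.
have nsCG : 'C_G(P) <| G.
  by rewrite /normal subsetIl normsI ?normG ?norms_cent ?normal_norm.
have nCS : S \subset 'N('C_G(P)) := subset_trans sSG (normal_norm nsCG).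
rewrite -norm_joinEl //.
pose T := [set Q : {group gT} | (Q \subset G) && (Q \subset S <*> 'C_G(P))].
rewrite -(Sylow_transversal_gen (T := T) (G := G)).
- rewrite gen_subG; apply/bigcupsP=> Q; rewrite inE => /andP[_]; exact.
- by move=> Q; rewrite inE => /andP[].
move=> q _; have [-> | neq_qp] := eqVneq q p.
  by exists S; rewrite // inE sSG joing_subl.
have [Q sylQ] := Sylow_exists q G; have [sQG qQ _] := and3P sylQ.
exists Q => //; rewrite inE sQG (subset_trans _ (joing_subr _ _)) // subsetI sQG.
apply: cP; first exact: p_Sylow sylQ.
by apply: pi_pgroup qQ _; rewrite !inE.
Qed.

(** G induces on 'O_p(G) the same automorphisms as a Sylow p-subgroup S, so the
    upper central series of S, cut down to 'O_p(G), lies in that of G. *)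
Lemma pcore_hypercentral p G :
    (forall Q, Sylow G Q -> p^'.-group Q -> Q \subset 'C('O_p(G))) ->
  exists n, 'O_p(G) \subset 'Z_n(G).
Proof.
move=> cP; have [S sylS] := Sylow_exists p G; have [sSG pS _] := and3P sylS.
have sPS : 'O_p(G) \subset S := pcore_sub_Hall sylS.
have sGSC := sub_Sylow_mul_cent (pcore_normal p G) sylS cP.
have [n defS] := ucnP _ (pgroup_nil pS).
exists n; rewrite -(setIidPl sPS) -{1}defS {defS}.
elim: n => [|n IHn]; first by rewrite !ucn0 subsetIr.
have sXG : 'O_p(G) :&: 'Z_n.+1(S) \subset G by rewrite subIset ?pcore_sub.
rewrite (sub_ucnS n sXG) gen_subG.
apply/subsetP=> _ /imset2P[x g /setIP[Px Zx] Gg ->].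
have /mulsgP[s c Ss /setIP[Gc cPc] ->] := subsetP sGSC g Gg.
have Psx : [~ x, s] \in 'O_p(G).
  by rewrite groupMl ?groupV // memJ_norm // (subsetP (gFnorm _ G)) // (subsetP sSG).
have Zsx : [~ x, s] \in 'Z_n(S).
  by rewrite (subsetP (ucn_comm n S)) // mem_commg.
have /commgP/eqP cxc : commute x c by apply/commute_sym/(centP cPc).
have /commgP/conjg_fixP csc : commute [~ x, s] c by apply/commute_sym/(centP cPc).
by rewrite commgMJ cxc mul1g csc (subsetP IHn) // inE Psx.
Qed.

(** If all subgroups of 'O_p(G) are permutable in G, either the p'-elements act
    trivially on 'O_p(G) or all subgroups of 'O_p(G) are normal in G. *)
Lemma permutable_pcore_dichotomy p G :
    (forall A, A \subset 'O_p(G) -> permutable A G) ->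
  (forall Q, Sylow G Q -> p^'.-group Q -> Q \subset 'C('O_p(G))) \/
  (forall A, A \subset 'O_p(G) -> G \subset 'N(A)).
Proof.
set P := 'O_p(G); move=> permP; have nsPG : P <| G := pcore_normal p G.
have [sPG nPG] := andP nsPG; have pP : p.-group P := pcore_pgroup p G.
have nTI H A : H \subset G -> H :&: P = 1 -> A \subset P -> H \subset 'N(A).
  by move=> sHG tiHP sAP; apply: permutable_norm_TI nsPG sAP (permP A sAP) sHG tiHP.
have [/forallP cP | ] := boolP [forall Q : {group gT},
    (Sylow G Q && p^'.-group Q) ==> (Q \subset 'C(P))].
  by left=> Q sylQ p'Q; apply: implyP (cP Q) _; rewrite sylQ.
case/forallPn=> Q; rewrite negb_imply -andbA => /and3P[/SylowP[q _ sylQ] p'Q not_cPQ].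
right; have [sQG qQ _] := and3P sylQ.
have tiQP : Q :&: P = 1 by rewrite setIC coprime_TIg ?(pnat_coprime pP).
have tiCP : 'C_P(Q) = 1.
  by apply: power_aut_cent_TI pP p'Q _ not_cPQ => U sUP; apply: nTI.
(* Y is the group of all elements of G normalising every subgroup of P. *)
pose Y := (G :&: \bigcap_(U : {group gT} | U \subset P) 'N(U))%G.
have sYG : Y \subset G := subsetIl _ _.
have subY H : H \subset G -> H :&: P = 1 -> H \subset Y.
  by move=> sHG tiHP; rewrite subsetI sHG; apply/bigcapsP=> U sUP; apply: nTI.
have nsYG : Y <| G.
  rewrite /normal sYG; apply/subsetP=> g Gg; rewrite inE.
  apply/subsetP=> _ /imsetP[y /setIP[Gy /bigcapP nUy] ->].
  rewrite inE groupJ //=; apply/bigcapP=> U sUP.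
  rewrite -[gval U](conjsgKV g) normJ memJ_conjg (nUy (U :^ g^-1)%G) //=.
  by rewrite sub_conjgV (normsP nPG).
have sylQY : q.-Sylow(Y) Q by apply: pHall_subl sylQ; rewrite ?subY.
suff sGY : G \subset Y.
  move=> A sAP; apply: subset_trans sGY _.
  by apply: subset_trans (subsetIr _ _) _; apply: bigcap_inf.
(* It remains to see that 'N_G(Q) lies in Y, which holds as it meets P in the
   trivial group 'C_P(Q). *)
rewrite -(Frattini_arg nsYG sylQY) mul_subG // subY ?subsetIl //.
apply/trivgP; rewrite -tiCP subsetI subsetIr /=.
have sNQ : 'N_G(Q) :&: P \subset 'N(Q) by rewrite subIset // subsetIr.
rewrite centsC; apply/commG1P/trivgP; rewrite -tiQP subsetI commg_subl sNQ.
rewrite (subset_trans (commgS Q (subsetIr _ P))) // commg_subr.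
exact: subset_trans sQG nPG.
Qed.

Lemma Fitting_permutable_hypercentral G A :
    A \subset 'F(G) -> gcore A G = 1 ->
    (forall B, B \subset 'F(G) -> permutable B G) ->
  exists n, A \subset 'Z_n(G).
Proof.
move=> sAF coreA1 permF; apply: sub_ucn_Sylow => Q /SylowP[p _ sylQ].
have [sQA pQ _] := and3P sylQ; have sQF := subset_trans sQA sAF.
have hallP := nilpotent_pcore_Hall p (Fitting_nil G).
have sQP : Q \subset 'O_p(G) by rewrite -p_core_Fitting (sub_Hall_pcore hallP).
have [|cP|nP] := @permutable_pcore_dichotomy p G.
- by move=> B sBP; apply: permF; rewrite (subset_trans sBP) // -p_core_Fitting pcore_sub.
- have [n PZ] := pcore_hypercentral cP.
  by exists n; apply: subset_trans sQP PZ.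
by exists 0; rewrite ucn0 -coreA1 gcore_max ?nP.
Qed.

Lemma subnormal_nilpotent_Fitting G H : H <|<| G -> nilpotent H -> H \subset 'F(G).
Proof.
have [m] := ubnP #|G|; elim: m G => // m IHm G leGm snHG nilH.
have [defH | [K [snHK nsKG prKG]]] := subnormalEr snHG.
  by rewrite nilpotent_Fitting -?defH.
apply: subset_trans (IHm K _ snHK nilH) _.
  exact: leq_trans (proper_card prKG) _.
by rewrite Fitting_max ?Fitting_nil // gFnormal_trans.
Qed.

End Permutable.

(** * Passage to quotients *)

(** Permutability of A and H may be tested modulo a normal subgroup contained
    in A. *)
Lemma permute_quotient (gT : finGroupType) (A C G H : {group gT}) :
    C <| G -> C \subset A -> A \subset G -> H \subset G ->
  A / C * (H / C) = H / C * (A / C) -> A * H = H * A.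
Proof.
move=> /andP[_ nCG] sCA sAG sHG; have nCA := subset_trans sAG nCG.
have nCH := subset_trans sHG nCG.
rewrite -!quotientMl // => /(congr1 (fun B => coset C @*^-1 B)).
rewrite !quotientK ?mul_subG // !mulgA (mulSGid sCA) -(normC nCH) -mulgA.
by rewrite (mulSGid sCA).
Qed.

(** Any two subgroups of a common p-subgroup of G permute, for every prime p.
    Arbitrary p-subgroups are used in place of Sylow subgroups, which amounts
    to the same and makes the passage to quotients immediate. *)
Definition permutable_p_subgroups (gT : finGroupType) (G : {group gT}) : Prop :=
  forall (p : nat) (P A B : {group gT}), prime p -> p.-group P -> P \subset G ->
    A \subset P -> B \subset P -> A * B = B * A.

Lemma permutable_p_subgroups_quotient (gT : finGroupType) (G C : {group gT}) :
  C <| G -> permutable_p_subgroups G -> permutable_p_subgroups (G / C).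
Proof.
move=> nsCG modG p P A B p_pr pP sPG sAP sBP; have [sCG nCG] := andP nsCG.
pose P1 := (coset C @*^-1 P)%G.
have sP1G : P1 \subset G by rewrite sub_cosetpre_quo.
(* A Sylow p-subgroup S of the preimage of P maps onto the p-group P. *)
have [S sylS] := Sylow_exists p P1; have [sSP1 pS _] := and3P sylS.
have sSG := subset_trans sSP1 sP1G; have nCS := subset_trans sSG nCG.
have defP : S / C = P.
  have := quotient_pHall nCS sylS; rewrite cosetpreK => sylSC.
  exact: pHall_id sylSC pP.
have lift (D : {group coset_of C}) :
    D \subset P -> exists2 D1 : {group gT}, D1 \subset S & D1 / C = D.
  move=> sDP; exists (coset C @*^-1 D :&: S)%G; first exact: subsetIr.
  by rewrite /= quotientGI ?sub_cosetpre // cosetpreK defP; apply/setIidPl.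
have [[A1 sA1 <-] [B1 sB1 <-]] := (lift A sAP, lift B sBP).
rewrite -!quotientMl ?(subset_trans sA1) ?(subset_trans sB1) //.
by rewrite (modG p S A1 B1).
Qed.

Lemma PT_group_quotient (gT : finGroupType) (G C : {group gT}) :
  C <| G -> PT_group G -> PT_group (G / C).
Proof.
move=> nsCG PTG A snA; have [sCG nCG] := andP nsCG.
have snA1 : (coset C @*^-1 A)%G <|<| G.
  rewrite -[gval G](quotientGK nsCG); case/subnormalP: snA => s.
  elim: s A => [|B s IHs] A /=.
    by move=> _ ->; apply: subnormal_refl.
  case/andP=> nsAB Bs /(IHs B Bs); apply: subnormal_trans.
  by apply: normal_subnormal; rewrite cosetpre_normal.
have [sA1G permA1] := PTG _ snA1; split; first exact: subnormal_sub snA.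
move=> H sHG; pose H1 := (coset C @*^-1 H)%G.
have sH1G : H1 \subset G by rewrite sub_cosetpre_quo.
have /(congr1 (fun B => B / C)) := permA1 H1 sH1G.
rewrite !quotientMl ?(subset_trans sA1G) ?(subset_trans sH1G) //.
by rewrite !cosetpreK.
Qed.

Section Closures.

Variable gT : finGroupType.
Implicit Types (A B C G H N P S : {group gT}).

Lemma sub_normal_closure A G : A \subset normal_closure A G.
Proof. by rewrite sub_gen ?sub_class_support. Qed.

Lemma normal_closure_normal A G : A \subset G -> normal_closure A G <| G.
Proof.
move=> sAG; rewrite /normal gen_subG class_support_sub_norm ?normG //=.
exact: subset_trans (class_support_norm _ _) (norm_gen _).
Qed.

Lemma normal_closure_min A G N :
  A \subset N -> G \subset 'N(N) -> normal_closure A G \subset N.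
Proof. by move=> sAN nNG; rewrite gen_subG class_support_sub_norm. Qed.

Lemma normal_closure_quotient A G C (N : {group coset_of C}) :
    C <| G -> A \subset G -> A / C \subset N -> N <| G / C ->
  normal_closure A G / C \subset N.
Proof.
move=> nsCG sAG sAN nsNG; have [_ nCG] := andP nsCG.
have ns_cl := normal_closure_normal sAG.
rewrite sub_quotient_pre; last exact: subset_trans (normal_sub ns_cl) nCG.
apply: (@normal_closure_min A G (coset C @*^-1 N)%G) => /=.
  by rewrite -sub_quotient_pre ?(subset_trans sAG nCG).
have: coset C @*^-1 N <| coset C @*^-1 (G / C) by rewrite cosetpre_normal.
by rewrite quotientGK // => /normal_norm.
Qed.

Lemma core_normal A G : A \subset G -> core A G <| G.
Proof. exact: gcore_normal. Qed.

Lemma core_sub A G : core A G \subset A.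
Proof. exact: gcore_sub. Qed.

Lemma gcore_quotient_core A G : A \subset G -> gcore (A / core A G) (G / core A G) = 1.
Proof.
move=> sAG; set C := core A G; have nsCG : C <| G := core_normal sAG.
have sCA : C \subset A := core_sub A G.
have nsCA : C <| A := normalS sCA sAG nsCG.
pose N := [group of gcore (A / C) (G / C)].
have sNA : coset C @*^-1 N \subset A by rewrite sub_cosetpre_quo // gcore_sub.
have nsNG : N <| G / C by rewrite gcore_normal ?quotientS.
have: coset C @*^-1 N <| coset C @*^-1 (G / C) by rewrite cosetpre_normal.
rewrite quotientGK // => /normal_norm nNG.
have sNC : coset C @*^-1 N \subset C by apply: gcore_max.
by apply/trivgP; have := quotientS C sNC; rewrite cosetpreK trivg_quotient.
Qed.

Lemma L_nilpotentP A G :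
  reflect (A \subset G /\ A / core A G \subset 'F(G / core A G))
          (A \in L_nilpotent G).
Proof.
rewrite inE; apply: (iffP andP) => -[sAG nilA]; split=> //.
  apply: subset_trans (quotientS _ (sub_normal_closure A G)) _.
  by apply: Fitting_max nilA; rewrite quotient_normal ?normal_closure_normal.
apply: nilpotentS (Fitting_nil (G / core A G)).
by rewrite normal_closure_quotient ?Fitting_normal ?core_normal.
Qed.

Lemma L_DeltaP A G :
  reflect (A \subset G /\ exists n, A / core A G \subset 'Z_n(G / core A G))
          (A \in L_Delta (central_chief_factors G) G).
Proof.
have sCcl : core A G \subset normal_closure A G.
  exact: subset_trans (core_sub A G) (sub_normal_closure A G).
rewrite inE; apply: (iffP andP) => -[sAG].
  case/(sub_ZDelta_centralP (core_normal sAG) (normal_closure_normal sAG) sCcl) => n clZ.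
  by split=> //; exists n; apply: subset_trans clZ; rewrite quotientS ?sub_normal_closure.
case=> n AZ; split=> //.
apply/(sub_ZDelta_centralP (core_normal sAG) (normal_closure_normal sAG) sCcl).
by exists n; rewrite normal_closure_quotient ?core_normal ?ucn_normal.
Qed.

Lemma L_Delta_sub_nilpotent G :
  L_Delta (central_chief_factors G) G \subset L_nilpotent G.
Proof.
apply/subsetP=> A /L_DeltaP[sAG [n AZ]]; apply/L_nilpotentP; split=> //.
by apply: subset_trans AZ _; rewrite Fitting_max ?ucn_normal ?ucn_nilpotent.
Qed.

End Closures.

(** * The two implications *)

Lemma PT_group_permutable_Fitting (gT : finGroupType) (G A : {group gT}) :
  PT_group G -> A \subset 'F(G) -> permutable A G.
Proof.
move=> PTG sAF; apply: PTG.
apply: subnormal_trans (nilpotent_subnormal (Fitting_nil G) sAF) _.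
exact: normal_subnormal (Fitting_normal G).
Qed.

(** The Fitting subgroup of C = 'C_G('F(G)) lies in 'F(G), so it is central in
    C, which forces C to be nilpotent. *)
Lemma sub_cent_Fitting (gT : finGroupType) (G : {group gT}) :
  solvable G -> 'C_G('F(G)) \subset 'F(G).
Proof.
move=> solG; set C := 'C_G('F(G)).
have nsCG : C <| G.
  by rewrite /normal subsetIl normsI ?normG ?norms_cent ?gFnorm.
have sFC : 'F(C) \subset 'F(G).
  by rewrite Fitting_max ?Fitting_nil // gFnormal_trans.
have nilC : nilpotent C.
  apply: (nilpotent_Fitting_hypercentral (n := 1) (G := [group of C])) => //.
    exact: solvableS (normal_sub nsCG) solG.
  rewrite ucn1 subsetI Fitting_sub /=.
  by rewrite (subset_trans sFC) // centsC subsetIr.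
exact: Fitting_max nsCG nilC.
Qed.

(** The case where 'O_p^'(G) is trivial, so that 'F(G) = 'O_p(G) contains its
    own centraliser. *)
Lemma pcore_PT_group_Sylow_permute (gT : finGroupType) (p : nat) (G P A B : {group gT}) :
    solvable G -> 'O_p^'(G) = 1 -> PT_group G -> p.-Sylow(G) P ->
  A \subset P -> B \subset P -> A * B = B * A.
Proof.
move=> solG Op'1 PTG sylP sAP sBP; have [sPG pP _] := and3P sylP.
have sAG := subset_trans sAP sPG; have sBG := subset_trans sBP sPG.
have defF := Fitting_eq_pcore Op'1.
have sCF : 'C_G('O_p(G)) \subset 'O_p(G) by rewrite -defF sub_cent_Fitting.
have sOP : 'O_p(G) \subset P := pcore_sub_Hall sylP.
have [|cO|nO] := @permutable_pcore_dichotomy _ p G.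
- by move=> D sDO; apply: PT_group_permutable_Fitting; rewrite ?defF.
- have sGP : G \subset P.
    apply: subset_trans (sub_Sylow_mul_cent (pcore_normal p G) sylP cO) _.
    by rewrite mul_subG // (subset_trans sCF).
  have nilG : nilpotent G := pgroup_nil (pgroupS sGP pP).
  by have [_ ->] := PTG A (nilpotent_subnormal nilG sAG).
have sG'O : G^`(1) \subset 'O_p(G).
  have nOG : G \subset 'N('O_p(G)) := gFnorm _ G.
  (* G acts on each cyclic subgroup of 'O_p(G), and the automorphisms of a
     cyclic group commute. *)
  have conjC u g h : u \in 'O_p(G) -> g \in G -> h \in G -> u ^ (g * h) = u ^ (h * g).
    move=> Ou Gg Gh.
    have nUG : G \subset 'N(<[u]>) by apply: nO; rewrite cycle_subG.
    have /cycleP[i ui] : u ^ g \in <[u]> by rewrite memJ_norm ?cycle_id ?(subsetP nUG).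
    have /cycleP[j uj] : u ^ h \in <[u]> by rewrite memJ_norm ?cycle_id ?(subsetP nUG).
    by rewrite !conjgM ui uj !conjXg ui uj -!expgM mulnC.
  apply: subset_trans sCF; rewrite subsetI der_sub /= gen_subG.
  apply/subsetP=> _ /imset2P[g h Gg Gh ->]; apply/centP=> u Ou.
  apply/commute_sym/commgP/conjg_fixP.
  have -> : [~ g, h] = (h * g)^-1 * (g * h) by rewrite commgEl conjgE invMg !mulgA.
  by rewrite conjgM conjC ?conjgKV // memJ_norm // groupV (subsetP nOG) ?groupM.
have nsPG : P <| G.
  by rewrite /normal sPG (sub_der1_norm (subset_trans sG'O sOP)).
have sPO : P \subset 'O_p(G) := pcore_max pP nsPG.
have nAB : B \subset 'N(A) by rewrite (subset_trans sBG) ?nO ?(subset_trans sAP).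
exact: esym (normC nAB).
Qed.

(** A Sylow p-subgroup is mapped isomorphically into G / 'O_p^'(G). *)
Lemma PT_group_Sylow_permute (gT : finGroupType) (p : nat) (G P A B : {group gT}) :
    solvable G -> PT_group G -> p.-Sylow(G) P ->
  A \subset P -> B \subset P -> A * B = B * A.
Proof.
move=> solG PTG sylP sAP sBP; have [sPG pP _] := and3P sylP.
set N := 'O_p^'(G); have nsNG : N <| G := pcore_normal _ G.
have nNP := subset_trans sPG (normal_norm nsNG).
have tiPN : P :&: N = 1.
  by rewrite coprime_TIg // (pnat_coprime pP (pcore_pgroup _ _)).
have sub_mul (C D : {group gT}) : C \subset P -> D \subset P ->
    C / N * (D / N) = D / N * (C / N) -> C * D \subset D * C.
  move=> sCP sDP; have nNC := subset_trans sCP nNP; have nND := subset_trans sDP nNP.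
  rewrite -!quotientMl // => eqCD.
  apply/subsetP=> x CDx.
  have Px : x \in P by rewrite (subsetP _ x CDx) // mul_subG.
  have: coset N x \in D * C / N by rewrite -eqCD mem_morphim ?(subsetP nNP).
  case/morphimP=> y _ DCy eqxy.
  have Py : y \in P by rewrite (subsetP _ y DCy) // mul_subG.
  suff -> : x = y by [].
  apply/eqP; rewrite eq_mulgV1 -in_set1 -[[set 1]]tiPN inE groupM ?groupV //=.
  rewrite -mem_rcoset; apply/rcoset_eqP.
  by rewrite -!val_coset ?eqxy // ?(subsetP nNP).
have eqAB : A / N * (B / N) = B / N * (A / N).
  apply: (@pcore_PT_group_Sylow_permute _ p (G / N)%G (P / N)%G).
  - exact: quotient_sol.
  - exact: trivg_pcore_quotient.
  - exact: PT_group_quotient.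
  - exact: quotient_pHall.
  - exact: quotientS.
  exact: quotientS.
by apply/eqP; rewrite eqEsubset !sub_mul.
Qed.

Lemma PT_group_L_nilpotent (gT : finGroupType) (G : {group gT}) :
  PT_group G -> L_nilpotent G = L_Delta (central_chief_factors G) G.
Proof.
move=> PTG; apply/eqP; rewrite eqEsubset L_Delta_sub_nilpotent andbT.
apply/subsetP=> A /L_nilpotentP[sAG AF]; apply/L_DeltaP; split=> //.
apply: (@Fitting_permutable_hypercentral _ (G / core A G)%G (A / core A G)%G) => //.
  exact: gcore_quotient_core.
move=> B; apply: PT_group_permutable_Fitting.
by apply: PT_group_quotient; rewrite ?core_normal.
Qed.

(** A hypercentral subgroup permutes with every subgroup as soon as subgroups
    of a common p-subgroup do. *)
Lemma hypercentral_permute (gT : finGroupType) n (G A H : {group gT}) :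
    permutable_p_subgroups G -> A \subset 'Z_n(G) -> H \subset G -> A * H = H * A.
Proof.
(* Permutability is reduced to an r-subgroup of A and a p-subgroup of H. *)
move=> modG sAZ sHG; apply: permute_Sylow => Q /SylowP[p p_pr sylQ].
symmetry; apply: permute_Sylow => R /SylowP[r r_pr sylR].
have [sQH pQ _] := and3P sylQ; have [sRA rR _] := and3P sylR.
have sQG := subset_trans sQH sHG; have sRZ := subset_trans sRA sAZ.
have hallR := nilpotent_pcore_Hall r (ucn_nilpotent n G).
have sRO : R \subset 'O_r('Z_n(G)) by rewrite (sub_Hall_pcore hallR).
have nsOG : 'O_r('Z_n(G)) <| G by rewrite gFnormal_trans ?ucn_normal.
have [eq_rp | neq_rp] := eqVneq r p.
  have pO : p.-group 'O_r('Z_n(G)) by rewrite eq_rp pcore_pgroup.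
  have [S sylS sQS] := Sylow_superset sQG pQ; have [sSG pS _] := and3P sylS.
  have sRS : R \subset S.
    by apply: subset_trans sRO _; apply: subset_trans (pcore_max pO nsOG) (pcore_sub_Hall sylS).
  by rewrite (modG p S Q R).
have cQR : Q \subset 'C('O_r('Z_n(G))).
  apply: (coprime_cent_hypercentral nsOG (pcore_sub _ _) sQG (pgroup_nil pQ)).
  apply: pnat_coprime (pcore_pgroup r _) _.
  by apply: pi_pgroup pQ _; rewrite !inE eq_sym.
by rewrite normC // (subset_trans cQR) // (subset_trans (centS sRO)) ?cent_sub.
Qed.

Lemma L_nilpotent_PT_group (gT : finGroupType) (G : {group gT}) :
    solvable G -> permutable_p_subgroups G ->
  L_nilpotent G = L_Delta (central_chief_factors G) G -> PT_group G.
Proof.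
move=> solG modG eqL A snA; have sAG := subnormal_sub snA; split=> // H sHG.
pose C := core A G; have nsCG : C <| G := core_normal sAG.
have sCA : C \subset A := core_sub A G.
have nsCA : C <| A := normalS sCA sAG nsCG.
have snAC : A / C <|<| G / C by apply: quotient_subnormal.
have snFA : 'F(A / C) <|<| G / C.
  by apply: subnormal_trans snAC; apply: normal_subnormal; apply: Fitting_normal.
have FAF : 'F(A / C) \subset 'F(G / C).
  by apply: subnormal_nilpotent_Fitting; rewrite ?Fitting_nil.
pose B := (coset C @*^-1 'F(A / C))%G.
have sCB : C \subset B by apply: sub_cosetpre.
have sBA : B \subset A by rewrite sub_cosetpre_quo ?Fitting_sub.
have sBG := subset_trans sBA sAG.
have coreB : core B G = C.
  apply/eqP; rewrite -val_eqE eqEsubset /=.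
  rewrite [X in X && _]gcore_max ?(subset_trans (core_sub B G)) ?gcore_norm //.
  by rewrite gcore_max ?normal_norm.
have nilA : nilpotent (A / C).
  have: B \in L_nilpotent G by apply/L_nilpotentP; rewrite coreB cosetpreK.
  rewrite eqL => /L_DeltaP[_ [n]]; rewrite coreB cosetpreK.
  by apply: nilpotent_Fitting_hypercentral; rewrite ?quotientS ?quotient_sol ?(solvableS sAG).
have: A \in L_nilpotent G.
  by apply/L_nilpotentP; split=> //; apply: subnormal_nilpotent_Fitting.
rewrite eqL => /L_DeltaP[_ [n AZ]].
apply: (permute_quotient nsCG) => //.
apply: hypercentral_permute AZ _; last exact: quotientS.
exact: permutable_p_subgroups_quotient.
Qed.

Theorem corollary1p8 (gT : finGroupType) (G : {group gT}) (solG : solvable G) :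
  PT_group G <->
    L_nilpotent G = L_Delta (central_chief_factors G) G /\
    (forall (p : nat) (P A B : {group gT}), prime p -> p.-Sylow(G) P ->
       A \subset P -> B \subset P -> A * B = B * A).
Proof.
split=> [PTG | [eqL modG]].
  split=> [|p P A B _ sylP]; first exact: PT_group_L_nilpotent.
  exact: PT_group_Sylow_permute solG PTG sylP.
apply: L_nilpotent_PT_group => // p Q A B p_pr pQ sQG sAQ sBQ.
have [P sylP sQP] := Sylow_superset sQG pQ.
by apply: (modG p P A B p_pr sylP); apply: subset_trans sQP.
Qed.
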